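(* Let $G$ be a finite simple graph and let $\varphi,\varphi'$ be sequences of pivot operations both applicable to $G$. If $\sup(\varphi)=\sup(\varphi')$, then $G\varphi=G\varphi'$.
   Context: Graphs are finite and simple. For a vertex $x$, $N(x)$ is its neighbourhood and $N'(x)=N(x)\cup\{x\}$. Pivot: for an edge $\{u,v\}\in E(G)$, let $V_1=N'(u)\setminus N'(v)$, $V_2=N'(v)\setminus N'(u)$, $V_3=N'(u)\cap N'(v)$; $G[uv]$ is obtained from $G$ by toggling every pair $\{x,y\}$ with $x\in V_i$, $y\in V_j$, $i\neq j$, all other adjacencies unchanged. A sequence $[v_1v_2]\cdots[v_{n-1}v_n]$ of pivots is applicable to $G$ if each $\{v_i,v_{i+1}\}$ is an edge of the graph obtained by applying the preceding pivots; $G\varphi$ is the resulting graph. The support $\sup(\varphi)=\{v_1\}\oplus\cdots\oplus\{v_n\}$ ($\oplus$ = symmetric difference) is the set of vertices occurring an odd number of times in the sequence. *)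

(* Defs.v *)
From HB Require Import structures.
From mathcomp Require Import all_boot.

Set Implicit Arguments.
Unset Strict Implicit.
Unset Printing Implicit Defensive.

Definition symdiff (U : finType) (X Y : {set U}) : {set U} :=
  (X :\: Y) :|: (Y :\: X).

(* The vertex set of a graph is the whole of T. *)
Record graph (T : finType) : Type := Graph {
  edges : {set {set T}};
  edgesP : [forall e in edges, #|e| == 2]
}.

HB.instance Definition _ (T : finType) := [isSub for @edges T].
HB.instance Definition _ (T : finType) := [Equality of graph T by <:].

Section Pivot.
Variable T : finType.
Implicit Types (G : graph T) (u v x : T) (A B : {set T}) (s : seq (T * T)).

Definition nbh G x : {set T} := [set y | [set x; y] \in edges G].

Definition cnbh G x : {set T} := x |: nbh G x.

Definition cross A B : {set {set T}} := [set [set x; y] | x in A, y in B].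

Definition toggled G u v : {set {set T}} :=
  let V1 := cnbh G u :\: cnbh G v in
  let V2 := cnbh G v :\: cnbh G u in
  let V3 := cnbh G u :&: cnbh G v in
  cross V1 V2 :|: cross V1 V3 :|: cross V2 V3.

Lemma pivot_subproof G u v :
  [forall e in symdiff (edges G) (toggled G u v), #|e| == 2].
Proof.
have crossP A B e : (forall x, x \in A -> x \notin B) ->
    e \in cross A B -> #|e| == 2.
  move=> dAB /imset2P[x y xA yB ->]; rewrite cards2.
  suff -> : x != y by [].
  by apply: contraNneq (dAB x xA) => ->.
apply/forall_inP=> e; rewrite /symdiff /toggled in_setU !in_setD.
case/orP.
  by case/andP=> _; apply: (forall_inP (edgesP G)).
case/andP=> _; rewrite !in_setU => /orP[/orP[]|] /crossP; apply=> x;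
  rewrite ?in_setD ?in_setI;
  by case: (x \in cnbh G u); case: (x \in cnbh G v).
Qed.

(* The formula makes sense for any u and v; it is the pivot G[uv] only when
   {u, v} is an edge, which applicable requires at each step. *)
Definition pivot G u v : graph T := Graph (pivot_subproof G u v).

Fixpoint applicable G s : bool :=
  if s is (u, v) :: s' then
    ([set u; v] \in edges G) && applicable (pivot G u v) s'
  else true.

Fixpoint pivots G s : graph T :=
  if s is (u, v) :: s' then pivots (pivot G u v) s' else G.

(* [:: (v1, v2); (v3, v4); ...] is sent to [:: v1; v2; v3; v4; ...]. *)
Definition verts s : seq T := flatten [seq [:: p.1; p.2] | p <- s].

Definition supp s : {set T} := \big[@symdiff T/set0]_(x <- verts s) [set x].

End Pivot.

Lemma in_supp (T : finType) (s : seq (T * T)) (x : T) :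
  (x \in supp s) = odd (count_mem x (verts s)).
Proof.
rewrite /supp; elim: (verts s) => [|y r IHr]; first by rewrite big_nil inE.
rewrite big_cons /symdiff !inE IHr /= oddD oddb eq_sym.
by case: (y == x); case: (odd _).
Qed.

(* Main.v *)
(* Let A be the adjacency matrix of G over GF(2).  Pivoting on an edge uv is the
   principal pivot transform of A on {u, v}: it acts on the subspace
   {(W, A W)} of pairs of vectors by exchanging W and A W at the coordinates u
   and v.  A sequence of pivots therefore exchanges exactly the coordinates in
   its support, and a graph is determined by its subspace. *)
Require Import Defs.
From mathcomp Require Import all_boot.

Set Implicit Arguments.
Unset Strict Implicit.
Unset Printing Implicit Defensive.

Section PivotSupport.
Variable T : finType.
Implicit Types (G H : graph T) (u v x y : T) (A B S W Z : {set T}).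

Definition adj G x y : bool := [set x; y] \in edges G.

Lemma adjC G x y : adj G x y = adj G y x.
Proof. by rewrite /adj setUC. Qed.

Lemma adjxx G x : adj G x x = false.
Proof.
apply/negP => /(forall_inP (edgesP G)).
by rewrite setUid cards1.
Qed.

Lemma in_cnbh G u x : (x \in cnbh G u) = (x == u) (+) adj G u x.
Proof. by rewrite !inE -/(adj G u x); case: eqVneq => // ->; rewrite adjxx. Qed.

Lemma graph_adj_inj G H : adj G =2 adj H -> G = H.
Proof.
move=> eGH; apply/val_inj/setP => e /=.
have [/cards2P[x [y [_ ->]]]|ne] := boolP (#|e| == 2); first exact: eGH.
by apply/idP/idP => /(forall_inP (edgesP _)) card_e; rewrite card_e in ne.
Qed.

Lemma in_cross A B x y :
  ([set x; y] \in cross A B) =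
  (x \in A) && (y \in B) || (y \in A) && (x \in B).
Proof.
apply/imset2P/orP => [[a b aA bB e]|].
  have xab : x \in [set a; b] by rewrite -e set21.
  have yab : y \in [set a; b] by rewrite -e set22.
  have axy : a \in [set x; y] by rewrite e set21.
  have bxy : b \in [set x; y] by rewrite e set22.
  move: xab yab axy bxy; rewrite !in_set2.
  by do 4![case/orP=> /eqP ?]; subst; rewrite ?aA ?bB; by [left | right].
case=> /andP[? ?]; first by exists x y.
by exists y x => //; rewrite setUC.
Qed.

(* The cross product over GF(2) of the membership vectors of x and y in
   (N'(u), N'(v)) vanishes iff one of them is zero or they are equal. *)
Lemma adj_pivot G u v x y :
  adj (pivot G u v) x y =
  adj G x y (+) (x \in cnbh G u) && (y \in cnbh G v)
            (+) (x \in cnbh G v) && (y \in cnbh G u).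
Proof.
rewrite {1}/adj /= /symdiff /toggled; move: (cnbh G u) (cnbh G v) => A B.
rewrite !in_setU !in_setD !in_setU !in_cross !in_setD !in_setI -/(adj G x y).
by case: (adj G x y); case: (x \in A); case: (x \in B);
  case: (y \in A); case: (y \in B).
Qed.

Lemma adj_pivot_edge G u v : adj G u v -> adj (pivot G u v) u v.
Proof.
move=> uv; rewrite adj_pivot !in_cnbh [adj G v u]adjC !adjxx uv !eqxx.
by rewrite [v == u]eq_sym; case: eqP uv => // ->; rewrite adjxx.
Qed.

(** Pivoting exchanges the closed neighbourhoods of [u] and [v], and the formula of [adj_pivot] is
    symmetric in these two sets, so a second pivot toggles the same pairs again. *)
Lemma pivotK G u v : adj G u v -> pivot (pivot G u v) u v = G.
Proof.
move=> uv; have vu : adj G v u by rewrite adjC.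
have uDv : (u == v) = false by apply: contraTF uv => /eqP->; rewrite adjxx.
have vDu : (v == u) = false by rewrite eq_sym.
have Nu : cnbh (pivot G u v) u = cnbh G v.
  apply/setP => x; rewrite in_cnbh adj_pivot !in_cnbh adjxx eqxx uDv vu.
  by case: (x == u); case: (x == v); case: (adj G u x); case: (adj G v x).
have Nv : cnbh (pivot G u v) v = cnbh G u.
  apply/setP => x; rewrite in_cnbh adj_pivot !in_cnbh adjxx eqxx vDu uv.
  by case: (x == u); case: (x == v); case: (adj G u x); case: (adj G v x).
apply: graph_adj_inj => x y; rewrite adj_pivot Nu Nv adj_pivot.
by case: (adj G x y); case: (_ && _); case: (_ && _).
Qed.

(** Subsets of [T] serve as vectors over GF(2); this is the product [A W]. *)
Definition adj_mul G W : {set T} :=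
  [set x | \big[addb/false]_y (adj G x y && (y \in W))].

Lemma in_adj_mul G W x :
  (x \in adj_mul G W) = \big[addb/false]_y (adj G x y && (y \in W)).
Proof. by rewrite inE. Qed.

Lemma big_addb_pred1 (F : T -> bool) x :
  \big[addb/false]_y (F y && (y == x)) = F x.
Proof.
rewrite (bigD1 x) //= eqxx andbT big1 ?addbF // => y /negPf->.
by rewrite andbF.
Qed.

Lemma adj_mul_set1 G x y : (x \in adj_mul G [set y]) = adj G x y.
Proof.
by rewrite in_adj_mul -[RHS]big_addb_pred1; apply: eq_bigr => z _; rewrite inE.
Qed.

(** Singletons are the basis vectors, and their images are the columns of the adjacency matrix. *)
Lemma adj_mul_inj G H : adj_mul G =1 adj_mul H -> G = H.
Proof.
by move=> eGH; apply: graph_adj_inj => x y; rewrite -!adj_mul_set1 eGH.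
Qed.

Lemma big_addb_cnbh G u W :
  \big[addb/false]_y ((y \in cnbh G u) && (y \in W)) =
  (u \in W) (+) (u \in adj_mul G W).
Proof.
rewrite in_adj_mul -[u \in W]big_addb_pred1 -big_split /=.
by apply: eq_bigr => y _; rewrite in_cnbh andb_addl [in LHS]andbC.
Qed.

(** By [adj_pivot] the new matrix is A + a b^T + b a^T, with a and b the indicator vectors of N'(u)
    and N'(v); a^T W and b^T W come from [big_addb_cnbh]. *)
Lemma in_adj_mul_pivot G u v W x :
  (x \in adj_mul (pivot G u v) W) =
  (x \in adj_mul G W)
    (+) (x \in cnbh G u) && ((v \in W) (+) (v \in adj_mul G W))
    (+) (x \in cnbh G v) && ((u \in W) (+) (u \in adj_mul G W)).
Proof.
rewrite -!big_addb_cnbh !big_distrr /= !in_adj_mul -!big_split /=.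
by apply: eq_bigr => y _; rewrite adj_pivot !andb_addl -!andbA.
Qed.

(* [exch S W Z] and [exch S Z W] are [W] and [Z] with their coordinates in [S]
   exchanged. *)
Definition exch S W Z : {set T} := (W :\: S) :|: (Z :&: S).

Lemma in_exch S W Z x :
  (x \in exch S W Z) = if x \in S then x \in Z else x \in W.
Proof. by rewrite !inE; case: (x \in S); rewrite ?andbT ?andbF ?orbF. Qed.

Lemma exchK S W Z : exch S (exch S W Z) (exch S Z W) = W.
Proof. by apply/setP => x; rewrite !in_exch; case: (x \in S). Qed.

Lemma exch_exch S S' W Z :
  exch S (exch S' W Z) (exch S' Z W) = exch (symdiff S S') W Z.
Proof.
apply/setP => x; rewrite !in_exch in_setU !in_setD.
by case: (x \in S); case: (x \in S').
Qed.

(** Linearity: the exchange adds (W + Z)_u e_u + (W + Z)_v e_v to W. *)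
Lemma in_adj_mul_exch2 G u v W Z x : u != v ->
  (x \in adj_mul G (exch [set u; v] W Z)) =
  (x \in adj_mul G W) (+) adj G x u && ((u \in W) (+) (u \in Z))
                      (+) adj G x v && ((v \in W) (+) (v \in Z)).
Proof.
move=> uDv; rewrite -[adj G x u]big_addb_pred1 -[adj G x v]big_addb_pred1.
rewrite !big_distrl !in_adj_mul -!big_split /=.
apply: eq_bigr => y _; rewrite in_exch in_set2; case: (adj G x y) => //=.
have [->|_] := eqVneq y u; first by rewrite (negPf uDv) /= addbF addKb.
by have [->|_] := eqVneq y v; rewrite /= ?addbF // addKb.
Qed.

(** Put p = (W + Z)_u and q = (W + Z)_v. Exchanging changes A W = Z into Z + p A e_u + q A e_v, and
    the pivot then adds p (e_u + A e_u) + q (e_v + A e_v). The columns cancel, leaving Z + p e_u + q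
    e_v. *)
Lemma adj_mul_pivot_exch G u v W : adj G u v ->
  let Z := adj_mul G W in
  adj_mul (pivot G u v) (exch [set u; v] W Z) = exch [set u; v] Z W.
Proof.
move=> uv Z; have vu : adj G v u by rewrite adjC.
have uDv : u != v by apply: contraTneq uv => ->; rewrite adjxx.
apply/setP => x; rewrite in_adj_mul_pivot !in_adj_mul_exch2 // -/Z !in_exch.
rewrite !adjxx uv vu !in_set2 !eqxx orbT /= !in_cnbh [adj G x u]adjC.
rewrite [adj G x v]adjC; have [->|_] := eqVneq x u.
  rewrite (negPf uDv) adjxx vu.
  by case: (u \in W); case: (u \in Z); case: (v \in W); case: (v \in Z).
have [->|_] := eqVneq x v.
  rewrite adjxx uv.
  by case: (u \in W); case: (u \in Z); case: (v \in W); case: (v \in Z).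
by case: (x \in Z); case: (u \in W); case: (u \in Z); case: (v \in W);
  case: (v \in Z); case: (adj G u x); case: (adj G v x).
Qed.

Lemma adj_mul_pivotP G u v W Z : adj G u v ->
  adj_mul (pivot G u v) (exch [set u; v] W Z) = exch [set u; v] Z W <->
  adj_mul G W = Z.
Proof.
move=> uv; split=> [eZ|<-]; last exact: adj_mul_pivot_exch.
(* For the converse, pivot back on the same edge: both the pivot and the exchange are
   involutions. *)
have := adj_mul_pivot_exch (exch [set u; v] W Z) (adj_pivot_edge uv).
by rewrite /= eZ pivotK // !exchK.
Qed.

Lemma supp_cons u v (s : seq (T * T)) : u != v ->
  supp ((u, v) :: s) = symdiff (supp s) [set u; v].
Proof.
move=> uDv; apply/setP => x.
rewrite in_setU !in_setD !in_supp /= !oddD !oddb in_set2 ![x == _]eq_sym.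
have [<-|_] := eqVneq u x; last by case: (v == x); case: (odd _).
by rewrite eq_sym (negPf uDv); case: (odd _).
Qed.

Lemma adj_mul_pivotsP (s : seq (T * T)) G W Z : applicable G s ->
  adj_mul (pivots G s) (exch (supp s) W Z) = exch (supp s) Z W <->
  adj_mul G W = Z.
Proof.
elim: s G W Z => [|[u v] s IHs] G W Z /=.
  have -> : supp ([::] : seq (T * T)) = set0 by rewrite /supp big_nil.
  by rewrite /exch !setD0 !setI0 !setU0.
case/andP=> uv ap_s.
have uDv : u != v by apply: contraTneq uv => ->; rewrite -/(adj G v v) adjxx.
(* The first pivot gives the inner exchange, the remaining ones the outer. *)
rewrite supp_cons // -!exch_exch.
exact: iff_trans (IHs _ _ _ ap_s) (adj_mul_pivotP _ _ uv).
Qed.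

End PivotSupport.

Theorem theorem3 (T : finType) (G : graph T) (phi phi' : seq (T * T))
    (hphi : applicable G phi) (hphi' : applicable G phi')
    (hsupp : supp phi = supp phi') :
  pivots G phi = pivots G phi'.
Proof.
apply: adj_mul_inj => W; set Z := adj_mul _ W; symmetry.
(* The pair (W, Z) is carried back along [phi] to a pair (W0, Z0) for [G], then forward along
   [phi']; equal supports make the two exchanges cancel. *)
pose W0 := exch (supp phi) W Z; pose Z0 := exch (supp phi) Z W.
have /(adj_mul_pivotsP W0 Z0 hphi) :
    adj_mul (pivots G phi) (exch (supp phi) W0 Z0) = exch (supp phi) Z0 W0.
  by rewrite !exchK.
by move/(adj_mul_pivotsP W0 Z0 hphi'); rewrite -hsupp !exchK.
Qed.
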